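(* Let $n\ge 2$ and let $f(\mathbf{x})\in\mathbb{R}[x_1,\dots,x_n]$ be a polynomial of degree $d$. Then $f$ admits a monic symmetric determinantal representation of size $d$ of the form $$f(\mathbf{x})=\det(I+x_1D_1+x_2V_{12}D_2V_{12}^T+\dots+x_nV_{1n}D_nV_{1n}^T)$$ with real diagonal $d\times d$ matrices $D_1,\dots,D_n$ and real orthogonal $d\times d$ matrices $V_{12},\dots,V_{1n}$, if and only if there exist real diagonal $d\times d$ matrices $D_1,\dots,D_n$ and real orthogonal $d\times d$ matrices $V_{ij}$ $(1\le i<j\le n)$ such that, writing $A_{ij}=V_{ij}D_jV_{ij}^T$, the following conditions hold: (i) each of the $\binom n2$ bivariate polynomials $f_{(x_i,x_j)}$, $1\le i<j\le n$, has the monic symmetric determinantal representation $f_{(x_i,x_j)}=\det(I+x_iD_i+x_jA_{ij})$ of size $d$; (ii) these coefficient matrices satisfy the compatibility condition $A_{1j}V_{1k}=V_{1k}A_{kj}$ for each of the $\binom{n-1}{2}$ triplets $(V_{1k},V_{1j},V_{kj})$, $2\le k<j\le n$; (iii) the $n$-tuple of coefficient matrices $(D_1,A_{12},A_{13},\dots,A_{1n})$ satisfies all the coefficients of the mixed monomials in $3$ to $n$ variables, i.e. for every monomial involving at least three of the variables $x_1,\dots,x_n$, its coefficient in $f$ equals its coefficient in $\det(I+x_1D_1+x_2A_{12}+\dots+x_nA_{1n})$.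
   Context: $f_{(x_i,x_j)}$ denotes the bivariate polynomial in $x_i,x_j$ obtained from $f$ by setting the other $n-2$ variables to zero. A monic symmetric determinantal representation (MSDR) of size $d$ of a polynomial $g$ is an expression $g=\det(I+\sum_i x_iA_i)$ with real symmetric $d\times d$ matrices $A_i$ and $I$ the identity matrix. *)

(* Defs.v *)
From HB Require Import structures.
From mathcomp Require Import all_boot all_order all_algebra.
(* [reals] is not imported: its dependencies' notations clash with [mpoly]'s. *)
From mathcomp Require reals.
From mathcomp Require Import mpoly.

Set Implicit Arguments.
Unset Strict Implicit.
Unset Printing Implicit Defensive.

Export reals.Real.Exports.
Import GRing.Theory.
Local Open Scope ring_scope.

Definition linear_pencil (R : comNzRingType) (n d : nat) (A : n.-tuple 'M[R]_d) :
    'M[{mpoly R[n]}]_d :=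
  1%:M + \sum_(k < n) 'X_k *: map_mx (@mpolyC n R) (tnth A k).

Definition is_msdr (R : comNzRingType) (n d : nat) (g : {mpoly R[n]})
    (A : n.-tuple 'M[R]_d) : Prop :=
  (forall k : 'I_n, (tnth A k)^T = tnth A k) /\ g = \det (linear_pencil A).

(* The two surviving variables x_i and x_j become ['X_0] and ['X_1] of
   [{mpoly R[2]}]; meant for [i != j]. *)
Definition bivariate (R : comNzRingType) (n : nat) (f : {mpoly R[n]})
    (i j : 'I_n) : {mpoly R[2]} :=
  f \mPo [tuple if k == i then 'X_(0 : 'I_2)
                else if k == j then 'X_(1 : 'I_2) else 0 | k < n].

Definition orthogonal_mx (R : comNzRingType) (d : nat) (V : 'M[R]_d) : Prop :=
  V *m V^T = 1%:M.

Definition first_var (n : nat) (hn : (2 <= n)%N) : 'I_n := Ordinal (ltnW hn).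

Definition first_diag_tuple (R : comNzRingType) (n d : nat) (hn : (2 <= n)%N)
    (D A : 'I_n -> 'M[R]_d) : n.-tuple 'M[R]_d :=
  [tuple if k == first_var hn then D k else A k | k < n].

Definition mnm_nvars (n : nat) (m : 'X_{1..n}) : nat :=
  #|[set k : 'I_n | m k != 0%N]|.

(* Main.v *)
Require Import Defs.
From HB Require Import structures.
From mathcomp Require Import all_boot all_order all_algebra.
From mathcomp Require Import mpoly.

Set Implicit Arguments.
Unset Strict Implicit.
Unset Printing Implicit Defensive.

Import GRing.Theory.
Local Open Scope ring_scope.

(** Two mechanisms carry the proof.

    Changing the orthonormal basis, that is conjugating every coefficient
    matrix by one orthogonal matrix, leaves the determinant of a monic pencil
    unchanged ([det_linear_pencil_conj]).  Setting all variables but [x_i] and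
    [x_j] to zero turns the determinant of a pencil into the determinant of the
    two-variable pencil on the matrices of index [i] and [j]
    ([bivariate_det_pencil]).

    Given a representation with orthogonal matrices [V_12, ..., V_1n], so with
    eigenbases [W_1 = I] and [W_k = V_1k] of the coefficient matrices, put
    [V_ij = W_i^T W_j], the transition matrix from the j-th eigenbasis to the
    i-th one.  Then [A_ij = W_i^T A_1j W_i] is the j-th coefficient matrix read
    in the eigenbasis of the i-th one.  In that basis the restriction of [f] to
    [x_i, x_j] has coefficient matrices [D_i] and [A_ij], which is (i), and
    (ii) is the same formula multiplied by [W_i].

    Conversely, (iii) leaves only the coefficients of the monomials in at most
    two variables.  Each of them is a coefficient of some bivariate restriction
    ([mcoeff_bivariate], [mnm_nvars_le2]), so it is enough to compare the
    restrictions of [f] and of the determinant.  The compatibility condition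
    (ii) says that conjugation by [V_1i] sends the pencil on [(D_i, A_ij)],
    which represents the restriction of [f] by (i), to the one on
    [(A_1i, A_1j)], which represents that of the determinant. *)

(** * Orthogonal conjugation of pencils *)

Section Conjugation.
Variables (R : comNzRingType) (d : nat).
Implicit Types A D V W : 'M[R]_d.

Lemma orthogonal_mxC V : orthogonal_mx V -> V^T *m V = 1%:M.
Proof. exact: mulmx1C. Qed.

Lemma orthogonal_mx_tr V : orthogonal_mx V -> orthogonal_mx V^T.
Proof. by move=> oV; rewrite /orthogonal_mx trmxK orthogonal_mxC. Qed.

Lemma orthogonal_mxM V W :
  orthogonal_mx V -> orthogonal_mx W -> orthogonal_mx (V *m W).
Proof.
move=> oV oW; rewrite /orthogonal_mx trmx_mul mulmxA -(mulmxA V).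
by rewrite oW mulmx1.
Qed.

Lemma orthogonal_mx1 : orthogonal_mx (1%:M : 'M[R]_d).
Proof. by rewrite /orthogonal_mx mul1mx trmx1. Qed.

Lemma trmx_diag D : is_diag_mx D -> D^T = D.
Proof. by case/diag_mxP=> v ->; rewrite tr_diag_mx. Qed.

Lemma trmx_conj V A : A^T = A -> (V *m A *m V^T)^T = V *m A *m V^T.
Proof. by move=> sA; rewrite !trmx_mul trmxK sA mulmxA. Qed.

(** The constant term of the pencil is the identity, which an orthogonal [V]
    fixes, so the whole pencil gets conjugated, and the factors [\det V] and
    [\det V^T] cancel. *)
Lemma det_linear_pencil_conj n V (A B : n.-tuple 'M[R]_d) :
    orthogonal_mx V -> (forall k, tnth B k = V *m tnth A k *m V^T) ->
  \det (linear_pencil B) = \det (linear_pencil A).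
Proof.
move=> oV defB; pose c (M : 'M[R]_d) := map_mx (@mpolyC n R) M.
have cM M N : c (M *m N) = c M *m c N by apply: map_mxM.
have cV : c V *m c V^T = 1%:M by rewrite -cM oV /c map_mx1.
suff ->: linear_pencil B = c V *m linear_pencil A *m c V^T.
  by rewrite !det_mulmx mulrAC -det_mulmx cV det1 mul1r.
rewrite /linear_pencil mulmxDr mulmx1 mulmxDl cV mulmx_sumr mulmx_suml.
congr (_ + _); apply: eq_bigr => k _.
by rewrite -scalemxAr -scalemxAl defB -[map_mx _ _]/(c _) !cM.
Qed.

End Conjugation.

(** * Restriction to two variables *)

Lemma tnth2 (T : Type) (x y : T) (k : 'I_2) :
  tnth [tuple x; y] k = if k == ord0 then x else y.
Proof. by rewrite (tnth_nth x); case: k => [[|[|//]] ?]. Qed.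

Section Bivariate.
Variables (R : comNzRingType) (n : nat).
Implicit Types (f : {mpoly R[n]}) (i j k : 'I_n) (m : 'X_{1..n}).

(** The substitution defining [bivariate], named so that proofs can fold it. *)
Definition bivariate_subst i j : n.-tuple {mpoly R[2]} :=
  [tuple if k == i then 'X_(0 : 'I_2)
         else if k == j then 'X_(1 : 'I_2) else 0 | k < n].

Definition mnm_restrict i j m : 'X_{1..2} :=
  [multinom if k == ord0 then m i else m j | k < 2].

(** A monomial outside [x_i, x_j] is killed by the restriction, and a monomial
    in [x_i, x_j] is recovered from its two exponents. *)
Lemma mcoeff_bivariateX i j m m' :
    i != j -> (forall k, k != i -> k != j -> m k = 0%N) ->
  (bivariate ('X_[m'] : {mpoly R[n]}) i j)@_(mnm_restrict i j m)
    = (m' == m)%:R :> R.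
Proof.
move=> nij mS; rewrite /bivariate comp_mpolyX -/(bivariate_subst i j).
have [k /and3P[ki kj k0]|m'S] :=
  pickP [pred k | [&& k != i, k != j & m' k != 0%N]].
  rewrite (bigD1 k) //= tnth_mktuple (negPf ki) (negPf kj) expr0n (negPf k0).
  rewrite mul0r mcoeff0; case: eqP => // e.
  by rewrite e mS ?eqxx in k0.
have ji : j != i by rewrite eq_sym.
rewrite (bigD1 i) //= (bigD1 j) //= !tnth_mktuple eqxx (negPf ji) eqxx.
rewrite big1 ?mulr1; last first.
  move=> k /andP[ki kj]; rewrite tnth_mktuple (negPf ki) (negPf kj).
  by have := m'S k; rewrite /= ki kj /= => /negbFE/eqP->; rewrite expr0.
rewrite !mpolyXn -mpolyXD mcoeffX.
have ->: (U_(0%R) *+ m' i + U_(1%R) *+ m' j)%MM = mnm_restrict i j m'.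
  apply/mnmP=> k; rewrite mnmDE !mulmnE !mnmE.
  by case: k => [[|[|//]] ?]; rewrite !(mul0n, mul1n, addn0).
congr (nat_of_bool _)%:R; apply/eqP/eqP=> [/mnmP e|-> //].
apply/mnmP=> k.
have [->|ki] := eqVneq k i; first by have := e ord0; rewrite !mnmE.
have [->|kj] := eqVneq k j; first by have := e (lift ord0 ord0); rewrite !mnmE.
by have := m'S k; rewrite /= ki kj /= => /negbFE/eqP->; rewrite mS.
Qed.

(** Restriction loses nothing about the monomials in [x_i, x_j] only: distinct
    monomials surviving it stay distinct. *)
Lemma mcoeff_bivariate f i j m :
    i != j -> (forall k, k != i -> k != j -> m k = 0%N) ->
  (bivariate f i j)@_(mnm_restrict i j m) = f@_m.
Proof.
move=> nij mS; rewrite {2}[f]mpolyE /bivariate comp_mpolyEX !raddf_sum /=.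
apply: eq_bigr => m' _; rewrite !mcoeffZ mcoeffX; congr (_ * _).
exact: mcoeff_bivariateX.
Qed.

(** Restriction is a ring morphism, hence commutes with the determinant, and
    it kills every summand of the pencil except the two of index [i] and [j]. *)
Lemma bivariate_det_pencil d i j (A : n.-tuple 'M[R]_d) : i != j ->
  bivariate (\det (linear_pencil A)) i j
    = \det (linear_pencil [tuple tnth A i; tnth A j]).
Proof.
move=> nij; have ji : j != i by rewrite eq_sym.
rewrite /bivariate -/(bivariate_subst i j) -det_map_mx; congr (\det _).
rewrite /linear_pencil map_mxD map_mx1 map_mx_sum; congr (_ + _).
rewrite (bigD1 i) //= (bigD1 j) //= big1 ?addr0; last first.
  move=> k /andP[ki kj]; rewrite map_mxZ /= comp_mpolyXU -tnth_nth tnth_mktuple.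
  by rewrite (negPf ki) (negPf kj) scale0r.
rewrite !map_mxZ /= !comp_mpolyXU -!tnth_nth !tnth_mktuple eqxx (negPf ji) eqxx.
have constE (M : 'M[R]_d) :
    map_mx (comp_mpoly (bivariate_subst i j)) (map_mx (@mpolyC n R) M)
      = map_mx (@mpolyC 2 R) M.
  by apply/matrixP=> a b; rewrite !mxE comp_mpolyC.
by rewrite !constE big_ord_recl big_ord1.
Qed.

(** Monomials in no or one variable also need two distinct indices, to be seen
    by some restriction; two exist because there are at least two variables. *)
Lemma mnm_nvars_le2 m : (2 <= n)%N -> (mnm_nvars m < 3)%N ->
  exists i j, (i < j)%N /\ forall k, k != i -> k != j -> m k = 0%N.
Proof.
move=> n2 m3; suff [i [j [nij mS]]] : exists i j, i != j /\
    forall k, k != i -> k != j -> m k = 0%N.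
  case: (ltngtP i j) => [ij|ji|/val_inj e]; last by rewrite e eqxx in nij.
    by exists i, j.
  by exists j, i; split=> // k kj ki; apply: mS.
have mE k : k \notin [set k | m k != 0%N] -> m k = 0%N.
  by rewrite inE negbK => /eqP.
(* If the support is not a pair, one index covers it, and any other will do. *)
have [c2|c1] := eqVneq (mnm_nvars m) 2.
  have /cards2P[i [j [nij e]]] : #|[set k : 'I_n | m k != 0%N]| == 2 by apply/eqP.
  exists i, j; split=> // k ki kj; apply: mE.
  by rewrite e !inE negb_or ki kj.
have [i iS] : exists i, [set k | m k != 0%N] \subset [set i].
  have [e|/set0Pn[i i_m]] := eqVneq [set k | m k != 0%N] set0.
    by exists (first_var n2); rewrite e sub0set.
  have := m3; rewrite ltnS leq_eqVlt (negPf c1) /= ltnS => c.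
  have /eqP <- : [set i] == [set k | m k != 0%N].
    by rewrite eqEcard sub1set i_m cards1.
  by exists i.
have [j ji] : exists j, j != i.
  have /card_gt0P[j] : (0 < #|[set~ i]|)%N by rewrite cardsC1 card_ord -subn1 subn_gt0.
  by rewrite !inE => ji; exists j.
exists i, j; split=> [|k ki _]; first by rewrite eq_sym.
by apply: mE; apply: contra ki => /(subsetP iS); rewrite inE.
Qed.

End Bivariate.

(** * The equivalence *)

Theorem theorem5p6 (R : realType) (n : nat) (hn : (2 <= n)%N) (d : nat)
    (f : {mpoly R[n]}) (hf : msize f = d.+1) :
  (exists (D : 'I_n -> 'M[R]_d) (V : 'I_n -> 'M[R]_d),
     [/\ forall k : 'I_n, is_diag_mx (D k),
         forall k : 'I_n, (first_var hn < k)%N -> orthogonal_mx (V k)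
       & is_msdr f (first_diag_tuple hn D (fun k => V k *m D k *m (V k)^T))])
  <->
  (exists (D : 'I_n -> 'M[R]_d) (V : 'I_n -> 'I_n -> 'M[R]_d),
     let A (i j : 'I_n) : 'M[R]_d := V i j *m D j *m (V i j)^T in
     let o := first_var hn in
     [/\ forall k : 'I_n, is_diag_mx (D k),
         forall i j : 'I_n, (i < j)%N -> orthogonal_mx (V i j),
         forall i j : 'I_n, (i < j)%N ->
           is_msdr (bivariate f i j) [tuple D i; A i j],
         forall k j : 'I_n, (o < k)%N -> (k < j)%N ->
           A o j *m V o k = V o k *m A k j
       & forall m : 'X_{1..n}, (3 <= mnm_nvars m)%N ->
           f@_m = (\det (linear_pencil (first_diag_tuple hn D (A o))))@_m]).
Proof.
split=> [[D [V [diagD oV [symB fE]]]] | [D [V [diagD oV biv compat mixed]]]].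
- (* With [W_1 = I], the first coefficient matrix [D_1] has the same form
     [W_k D_k W_k^T] as the others. *)
  pose W k := if k == first_var hn then 1%:M else V k.
  have oW k : orthogonal_mx (W k).
    rewrite /W; case: eqVneq => [_|nk]; first exact: orthogonal_mx1.
    by apply: oV; rewrite lt0n.
  have W1 : W (first_var hn) = 1%:M by rewrite /W eqxx.
  set B := first_diag_tuple _ _ _ in symB fE.
  have BE k : tnth B k = W k *m D k *m (W k)^T.
    rewrite tnth_mktuple /W; case: eqP => // _.
    by rewrite mul1mx trmx1 mulmx1.
  exists D, (fun i j => (W i)^T *m W j) => A o.
  have AE i j : A i j = (W i)^T *m tnth B j *m W i.
    by rewrite /A BE trmx_mul trmxK !mulmxA.
  have AoE j : A o j = tnth B j by rewrite AE W1 trmx1 mul1mx mulmx1.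
  split=> //.
  + by move=> i j _; apply/orthogonal_mxM/oW/orthogonal_mx_tr.
  + move=> i j ij; split=> [k|].
      rewrite !tnth2; case: eqP => _; first exact: trmx_diag.
      by apply: trmx_conj; apply: trmx_diag.
    rewrite fE bivariate_det_pencil; last first.
      by apply: contraTneq ij => ->; rewrite ltnn.
    (* Conjugating by [W_i] returns from the i-th eigenbasis to the common one. *)
    apply: (det_linear_pencil_conj (oW i)) => k.
    rewrite !tnth2; case: eqP => _; first exact: BE.
    rewrite AE BE !mulmxA oW mul1mx -!mulmxA oW mulmx1.
    by rewrite !mulmxA.
  + by move=> k j _ _; rewrite W1 trmx1 mul1mx AoE AE !mulmxA oW mul1mx.
  + move=> m _; rewrite fE; congr (\det (linear_pencil _))@_m.
    apply: eq_from_tnth => k; rewrite [RHS]tnth_mktuple -/o AoE.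
    by rewrite !tnth_mktuple; case: eqP.
- exists D, (V (first_var hn)); pose o := first_var hn.
  pose A i j := V i j *m D j *m (V i j)^T.
  have {}compat (k j : 'I_n) : (o < k)%N -> (k < j)%N ->
    A o j *m V o k = V o k *m A k j by exact: compat.
  rewrite -/o in mixed *.
  split=> // [k ok|]; first exact: oV.
  set B := first_diag_tuple _ _ _.
  have BoE : tnth B o = D o by rewrite tnth_mktuple eqxx.
  have BE (k : 'I_n) : (o < k)%N -> tnth B k = A o k.
    by move=> ok; rewrite tnth_mktuple; case: eqP ok => // ->; rewrite ltnn.
  split=> [k|].
    have [->|nk] := eqVneq k o; first by rewrite BoE trmx_diag.
    rewrite BE ?lt0n //; exact/trmx_conj/trmx_diag.
  have bivE (i j : 'I_n) : (i < j)%N ->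
      bivariate f i j = bivariate (\det (linear_pencil B)) i j.
    move=> ij; have [_ ->] := biv i j ij.
    rewrite bivariate_det_pencil; last first.
      by apply: contraTneq ij => ->; rewrite ltnn.
    have oj : (o < j)%N by apply: leq_ltn_trans ij.
    have [->|ni] := eqVneq i o; first by rewrite BoE BE.
    have oi : (o < i)%N by rewrite lt0n.
    (* By the compatibility condition, conjugation by [V_1i] takes [D_i] to
       [A_1i] and [A_ij] to [A_1j]. *)
    rewrite (BE i oi) (BE j oj); symmetry.
    apply: (det_linear_pencil_conj (oV _ _ oi)) => k.
    rewrite !tnth2; case: eqP => _ //.
    by rewrite -compat // -mulmxA (oV _ _ oi) mulmx1.
  apply/mpolyP=> m; have [m3|m3] := ltnP (mnm_nvars m) 3; last exact: mixed.
  have [i [j [ij mS]]] := mnm_nvars_le2 hn m3.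
  have nij : i != j by apply: contraTneq ij => ->; rewrite ltnn.
  by rewrite -(mcoeff_bivariate f nij mS) bivE // mcoeff_bivariate.
Qed.
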